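(* Let $A,B\in M_n$. Let $f$ and $g$ be continuous functions $[0,1] \to \mathbb{R}$ satisfying $f(0) = g(1) = 1$ and $f(1) = g(0) = 0$, so that $\mathcal{C}_\alpha = f(\alpha)A+g(\alpha)B$ is a matrix path from $A$ to $B$. If $\max\{f(\alpha),g(\alpha)\} \geq 0$ for all $\alpha \in [0,1]$, then any convex eigenpairing $p:\Sigma(A)\to\Sigma(B)$ is also a $\mathcal{C}$-eigenpairing.
   Context: $M_n$ is the space of $n\times n$ complex matrices. A matrix path is a continuous function $\mathcal{C}:[0,1]\to M_n$, with value $\mathcal{C}_\alpha$ at $\alpha$; it is a path from $\mathcal{C}_0$ to $\mathcal{C}_1$. $\Sigma(A)$ denotes the spectrum of $A\in M_n$ as a multiset of size $n$ (eigenvalues with algebraic multiplicity). A $\mathcal{C}$-eigenpath set is a multiset $\{\gamma_1,\ldots,\gamma_n\}$ of continuous functions $\gamma_j:[0,1]\to\mathbb{C}$ (possibly not all distinct) such that $\Sigma(\mathcal{C}_\alpha)=\{\gamma_1(\alpha),\ldots,\gamma_n(\alpha)\}$ as multisets for all $\alpha\in[0,1]$. With $A=\mathcal{C}_0$, $B=\mathcal{C}_1$, a $\mathcal{C}$-eigenpairing is a bijection $p:\Sigma(A)\to\Sigma(B)$ induced by some $\mathcal{C}$-eigenpath set via $\gamma_j(0)\mapsto\gamma_j(1)$, $j=1,\ldots,n$; different copies of a repeated eigenvalue are regarded as distinct elements of the multiset. (Equivalently, fixing enumerations $\Sigma(A)=\{\lambda_1,\ldots,\lambda_n\}$, $\Sigma(B)=\{\mu_1,\ldots,\mu_n\}$,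 a permutation $\pi$ of $\{1,\dots,n\}$ gives an eigenpairing $\lambda_j\mapsto\mu_{\pi(j)}$ if there is a $\mathcal{C}$-eigenpath set with $\gamma_j(0)=\lambda_j$ and $\gamma_j(1)=\mu_{\pi(j)}$ for all $j$.) A convex eigenpairing of $A$ and $B$ is an eigenpairing for the convex matrix path $\alpha\mapsto(1-\alpha)A+\alpha B$. *)

(* Defs.v *)
From HB Require Import structures.
From mathcomp Require Import all_boot all_order all_algebra all_fingroup.
From mathcomp Require Import complex finmap multiset.
From mathcomp Require Import all_classical all_reals all_analysis.
Export numFieldNormedType.Exports.

Set Implicit Arguments.
Unset Strict Implicit.
Unset Printing Implicit Defensive.

Import Order.TTheory GRing.Theory Num.Theory.
Local Open Scope classical_set_scope.
Local Open Scope ring_scope.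
Local Open Scope complex_scope.

(* The topology of R[i] is the one induced by the modulus; 'M[R[i]]_n then
   carries the entrywise topology. *)
HB.instance Definition _ (R : realType) :=
  NormedModule.copy R[i] (R[i] : numFieldType)^o.

Definition spectrum (R : realType) (n : nat) (A : 'M[R[i]]_n) : {mset R[i]}%mset :=
  seq_mset (sval (closed_field_poly_normal (char_poly A))).

(* So the multiplicity in the spectrum is the algebraic multiplicity. *)
Lemma spectrumE (R : realType) (n : nat) (A : 'M[R[i]]_n) (x : R[i]) :
  spectrum A x = mup x (char_poly A).
Proof.
rewrite /spectrum mset_seqE; case: closed_field_poly_normal => s /= ->.
by rewrite (monicP (char_poly_monic A)) scale1r mu_prod_XsubC.
Qed.

Definition matrix_path (R : realType) (n : nat) (C : R -> 'M[R[i]]_n)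
    (A B : 'M[R[i]]_n) : Prop :=
  [/\ {within `[0, 1], continuous C}, C 0 = A & C 1 = B].

(* A multiset of n functions is given by an indexed family; the values outside
   [0, 1] of functions R -> _ are irrelevant. *)
Definition eigenpath_set (R : realType) (n : nat) (C : R -> 'M[R[i]]_n)
    (gamma : 'I_n -> R -> R[i]) : Prop :=
  (forall j, {within `[0, 1], continuous (gamma j)}) /\
  (forall a : R, 0 <= a <= 1 ->
     spectrum (C a) = seq_mset [seq gamma j a | j <- enum 'I_n]).

(* A bijection between multisets, with copies of a repeated element told
   apart, is a permutation p of the indices of enumerations lam and mu of the
   two multisets: it maps the copy lam_j to the copy mu_(p j). *)
Definition eigenpairing (R : realType) (n : nat) (C : R -> 'M[R[i]]_n)
    (lam mu : n.-tuple R[i]) (p : 'S_n) : Prop :=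
  exists2 gamma : 'I_n -> R -> R[i], eigenpath_set C gamma &
    forall j, gamma j 0 = tnth lam j /\ gamma j 1 = tnth mu (p j).

Definition convex_path (R : realType) (n : nat) (A B : 'M[R[i]]_n)
    (a : R) : 'M[R[i]]_n := (1 - a)%:C *: A + a%:C *: B.

Definition convex_eigenpairing (R : realType) (n : nat) (A B : 'M[R[i]]_n)
    (lam mu : n.-tuple R[i]) (p : 'S_n) : Prop :=
  eigenpairing (convex_path A B) lam mu p.

(* Main.v *)
Require Import Defs.
From HB Require Import structures.
From mathcomp Require Import all_boot all_order all_algebra all_fingroup.
From mathcomp Require Import complex finmap multiset.
From mathcomp Require Import all_classical all_reals all_analysis.
From mathcomp Require Import lra.

Set Implicit Arguments.
Unset Strict Implicit.
Unset Printing Implicit Defensive.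

Import Order.TTheory GRing.Theory Num.Theory.
Local Open Scope classical_set_scope.
Local Open Scope ring_scope.
Local Open Scope complex_scope.

(** In the plane of pairs [(x, y)] the hypothesis confines the path [(f, g)] to
    the cone [max x y >= 0], the union of three quadrants.  Eigenvalues of
    [x A + y B] are 1-homogeneous in [(x, y)], so a family of continuous
    eigenvalues on a segment extends to the quadrant that it spans; it is
    continuous at the origin because it is bounded on the segment.  The given
    convex eigenpath set serves for [x, y >= 0].  Continuous eigenvalues along
    the segments from [B] to [- A] and from [A] to [- B], with starting values
    prescribed by the convex eigenpath set, serve for the other two quadrants,
    and the three extensions agree on the common rays.

    Continuous eigenvalues along a continuous path [C] on [[0, 1]] exist by
    compactness: on a fine grid, match the eigenvalues of neighbouring points
    within small distance; during a short time each discrete trajectory stays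
    near the finite spectrum of a fixed [C s] while moving by small steps, so it
    moves little.  Hence the trajectories are equicontinuous, and their limit
    along an ultrafilter is a continuous choice of eigenvalues. *)

(** * Convergence of bounded functions along an ultrafilter *)

Lemma fmap_ultra (T U : Type) (h : T -> U) (F : set_system T) :
  UltraFilter F -> UltraFilter (h @ F).
Proof.
move=> FU; split; first exact: fmap_proper_filter.
move=> G GG sFG; apply/seteqP; split=> // A GA.
have [//|FnA] := in_ultra_setVsetC (h @^-1` A) FU.
have : G (A `&` ~` A) by apply: filterI => //; exact: sFG.
by rewrite setICr => /filter_not_empty.
Qed.

(** The image of [U] is an ultrafilter containing the compact segment [[- a, a]], hence it has a
    limit there. *)
Lemma ultra_bounded_cvgR (R : realType) (T : Type) (U : set_system T)
    (u : T -> R) (a : R) :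
  UltraFilter U -> (\forall t \near U, `|u t| <= a) ->
  exists l : R, u @ U --> l.
Proof.
move=> UU ua.
have := @segment_compact R (- a) a; rewrite compact_ultra.
move=> /(_ (u @ U) (fmap_ultra u UU)) [|l [_ ul]]; last by exists l.
by near=> t; rewrite /= in_itv /= -ler_norml; near: t.
Unshelve. all: by end_near. Qed.

Lemma continuous_real_complex (R : realType) : continuous (real_complex R).
Proof.
move=> x; apply/cvgrPdist_lt => e e0.
have ee : e = (complex.Re e)%:C by rewrite RRe_real// gtr0_real.
have e0' : 0 < complex.Re e by rewrite -ltcR -ee.
near=> y; rewrite -rmorphB/= ee.
have -> : `|(x - y)%:C| = `|x - y|%:C :> R[i].
  by rewrite normc_def /= expr0n addr0 sqrtr_sqr.
rewrite ltcR; near: y; exact: cvgr_dist_lt.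
Unshelve. all: by end_near. Qed.

Lemma ultra_bounded_cvg (R : realType) (T : Type) (U : set_system T)
    (u : T -> R[i]) (a : R[i]) :
  UltraFilter U -> (\forall t \near U, `|u t| <= a) ->
  exists l : R[i], u @ U --> l.
Proof.
move=> UU ua.
have [l1 ul1] : exists l : R, complex.Re (u t) @[t --> U] --> l.
  apply: (@ultra_bounded_cvgR _ _ _ _ (complex.Re a)) => //.
  near=> t; have h : `|u t| <= a by near: t.
  (* Norms take values in [R[i]], and so does the bound [a]; dominating a norm makes it real. *)
  have ra : a \is Num.real by rewrite ger0_real// (le_trans _ h).
  by rewrite -lecR RRe_real// (le_trans _ h)// normc_ge_Re.
have [l2 ul2] : exists l : R, complex.Im (u t) @[t --> U] --> l.
  apply: (@ultra_bounded_cvgR _ _ _ _ (complex.Re a)) => //.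
  near=> t; have h : `|u t| <= a by near: t.
  have ra : a \is Num.real by rewrite ger0_real// (le_trans _ h).
  rewrite -lecR RRe_real// (le_trans _ h)//.
  rewrite -normrN -ReiNIm (le_trans (normc_ge_Re _))// normrM.
  by rewrite [X in _ * X]normc_def/= expr0n expr1n add0r sqrtr1 mulr1.
exists (l1%:C + 'i * l2%:C).
rewrite (_ : u = fun t => (complex.Re (u t))%:C + 'i * (complex.Im (u t))%:C);
  last first.
  by apply/funext => t; rewrite [LHS]complexE.
apply: cvgD; first exact: (cvg_comp _ _ ul1 (@continuous_real_complex R _)).
apply: cvgM; first exact: cvg_cst.
exact: (cvg_comp _ _ ul2 (@continuous_real_complex R _)).
Unshelve. all: by end_near. Qed.

(** * Enumerations of the eigenvalues of a matrix *)

(** An indexed family, unlike a multiset, lets single eigenvalues be followed as the matrix varies;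
    the product form accounts for algebraic multiplicity. *)
Definition lists_eigenvalues (F : fieldType) (n : nat) (M : 'M[F]_n)
    (x : 'I_n -> F) : Prop :=
  char_poly M = \prod_j ('X - (x j)%:P).

(** A nonzero [p - q] cannot vanish at [size (p - q)] distinct natural numbers. *)
Lemma poly_ext (F : numDomainType) (p q : {poly F}) :
  (forall z, p.[z] = q.[z]) -> p = q.
Proof.
move=> pq; apply/eqP; rewrite -subr_eq0; apply: contraT => pq0.
have := max_poly_roots pq0 (rs := [seq k%:R | k <- iota 0 (size (p - q)%R)]).
rewrite size_map size_iota ltnn map_inj_uniq ?iota_uniq; last first.
  by move=> i j /eqP; rewrite eqr_nat => /eqP.
by apply=> //; apply/allP => z _; rewrite /root hornerD hornerN pq subrr.
Qed.

Lemma horner_char_poly (F : comNzRingType) (n : nat) (M : 'M[F]_n) (z : F) :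
  (char_poly M).[z] = \det (z%:M - M).
Proof.
rewrite -horner_evalE -det_map_mx; congr (\det _).
apply/matrixP => i j; rewrite !mxE /=.
rewrite -[LHS]/(('X *+ (i == j) - (M i j)%:P).[z]) hornerD hornerN hornerC.
by rewrite hornerMn hornerX.
Qed.

(** Evaluation at each [z] replaces an identity of polynomials by identities of scalars, which pass
    to limits. *)
Lemma lists_eigenvaluesP (F : numFieldType) (n : nat) (M : 'M[F]_n)
    (x : 'I_n -> F) :
  lists_eigenvalues M x <-> forall z, \det (z%:M - M) = \prod_j (z - x j).
Proof.
have xE z : (\prod_j ('X - (x j)%:P)).[z] = \prod_j (z - x j).
  by rewrite horner_prod; apply: eq_bigr => j _; rewrite hornerXsubC.
split=> [Mx z|Mx]; first by rewrite -horner_char_poly Mx xE.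
by apply: poly_ext => z; rewrite horner_char_poly Mx xE.
Qed.

Lemma lists_eigenvalues_root (F : fieldType) (n : nat) (M : 'M[F]_n)
    (x : 'I_n -> F) (j : 'I_n) :
  lists_eigenvalues M x -> eigenvalue M (x j).
Proof.
move=> Mx; rewrite eigenvalue_root_char Mx /root (bigD1 j)//= hornerM.
by rewrite hornerXsubC subrr mul0r.
Qed.

Lemma lists_eigenvalues_perm (F : fieldType) (n : nat) (M : 'M[F]_n)
    (x : 'I_n -> F) (s : 'S_n) :
  lists_eigenvalues M x -> lists_eigenvalues M (x \o s).
Proof.
rewrite /lists_eigenvalues => ->.
by rewrite (reindex_inj (@perm_inj _ s)).
Qed.

Lemma lists_eigenvalues_unique (F : fieldType) (n : nat) (M : 'M[F]_n)
    (x y : 'I_n -> F) :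
  lists_eigenvalues M x -> lists_eigenvalues M y ->
  exists s : 'S_n, forall j, x j = y (s j).
Proof.
rewrite /lists_eigenvalues => -> xy.
have : perm_eq (mktuple x) (mktuple y).
  by apply: prod_XsubC_eq; rewrite !big_image.
move=> /tuple_permP[s xys]; exists s => j.
have /val_inj/(congr1 (fun t => tnth t j)) := xys.
by rewrite !tnth_mktuple.
Qed.

Lemma lists_eigenvalues_scale (F : numFieldType) (n : nat) (M : 'M[F]_n)
    (x : 'I_n -> F) (c : F) :
  lists_eigenvalues M x -> lists_eigenvalues (c *: M) (fun j => c * x j).
Proof.
move=> /lists_eigenvaluesP Mx; apply/lists_eigenvaluesP => z.
have [->|c0] := eqVneq c 0.
  rewrite scale0r subr0 det_scalar -[in LHS](card_ord n) -prodr_const.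
  by apply: eq_bigr => j _; rewrite mul0r subr0.
rewrite (_ : z%:M - c *: M = c *: ((c^-1 * z)%:M - M)); last first.
  by rewrite scalerBr scale_scalar_mx mulrA mulfV// mul1r.
rewrite detZ Mx -[in c ^+ _](card_ord n) -prodr_const -big_split/=.
by apply: eq_bigr => j _; rewrite mulrBr mulrA mulfV// mul1r.
Qed.

Lemma spectrum_eqP (R : realType) (n : nat) (M : 'M[R[i]]_n) (s : seq R[i]) :
  spectrum M = seq_mset s <-> char_poly M = \prod_(z <- s) ('X - z%:P).
Proof.
rewrite /spectrum; case: closed_field_poly_normal => t /=.
rewrite (monicP (char_poly_monic M)) scale1r => ->; split.
  by move=> /eq_seq_msetP ts; apply: perm_big.
by move=> /prod_XsubC_eq ?; apply/eq_seq_msetP.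
Qed.

Lemma lists_eigenvalues_spectrum (R : realType) (n : nat) (M : 'M[R[i]]_n)
    (x : 'I_n -> R[i]) :
  lists_eigenvalues M x <-> spectrum M = seq_mset [seq x j | j <- enum 'I_n].
Proof.
rewrite spectrum_eqP /lists_eigenvalues big_map.
by rewrite (big_enum _ _ _ (fun j => 'X - (x j)%:P)).
Qed.

Lemma lists_eigenvalues_exists (F : closedFieldType) (n : nat) (M : 'M[F]_n) :
  exists x, lists_eigenvalues M x.
Proof.
have [s] := closed_field_poly_normal (char_poly M).
rewrite (monicP (char_poly_monic M)) scale1r => Ms.
have /eqP sn : size s == n.
  by rewrite -eqSS -(size_prod_XsubC s id) -Ms size_char_poly.
exists (fun j => s`_j); rewrite /lists_eigenvalues Ms.
by rewrite (big_nth 0) sn big_mkord.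
Qed.

(** Take l1 norms on both sides of [v *m M = a *: v] for a row eigenvector [v]. A crude bound
    suffices: it only has to keep eigenvalues bounded when the entries are. *)
Lemma eigenvalue_bound (F : numFieldType) (n : nat) (M : 'M[F]_n) (a : F) :
  eigenvalue M a -> `|a| <= \sum_i \sum_k `|M i k|.
Proof.
move=> /eigenvalueP[v vM v0].
have v0' : 0 < \sum_k `|v 0 k|.
  rewrite lt_neqAle sumr_ge0 ?andbT; last by move=> *; exact: normr_ge0.
  rewrite eq_sym; apply: contra v0 => /eqP/psumr_eq0P v0.
  apply/eqP/rowP => k; rewrite mxE; apply/eqP; rewrite -normr_eq0.
  by apply/eqP/v0 => // *; exact: normr_ge0.
rewrite -(ler_pM2r v0') mulr_sumr.
rewrite (eq_bigr (fun k => `|\sum_i v 0 i * M i k|)); last first.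
  by move=> k _; rewrite -normrM; have /rowP/(_ k) := vM; rewrite !mxE => ->.
rewrite exchange_big/= mulr_suml; apply: ler_sum => k _.
rewrite (le_trans (ler_norm_sum _ _ _))//.
rewrite mulr_suml; apply: ler_sum => i _; rewrite normrM mulrC ler_wpM2l//.
by rewrite (bigD1 i)//= lerDl sumr_ge0.
Qed.

(** * Limits and uniform continuity of the spectrum *)

Lemma cvg_det (R : realType) (n : nat) (T : Type) (F : set_system T)
    (M : T -> 'M[R[i]]_n) (M0 : 'M[R[i]]_n) :
  Filter F -> (forall i k, M t i k @[t --> F] --> M0 i k) ->
  \det (M t) @[t --> F] --> \det M0.
Proof.
move=> FF MM0; apply: cvg_big => [x|s _].
  by apply: cvgD; [exact: cvg_fst|exact: cvg_snd].
apply: cvgM; first exact: cvg_cst.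
apply: cvg_big => [x|i _]; last exact: MM0.
by apply: cvgM; [exact: cvg_fst|exact: cvg_snd].
Qed.

(** Convergent entries are bounded near [U], so the eigenvalues are bounded and each [x t j] has a
    limit. For fixed [z] both sides of [\det (z%:M - M t) = \prod_j (z - x t j)] then converge. *)
Lemma ultra_eigenvalues (R : realType) (n : nat) (T : Type) (U : set_system T)
    (M : T -> 'M[R[i]]_n) (M0 : 'M[R[i]]_n) (x : T -> 'I_n -> R[i]) :
  UltraFilter U ->
  (forall i k, M t i k @[t --> U] --> M0 i k) ->
  (forall t, lists_eigenvalues (M t) (x t)) ->
  exists2 x0, lists_eigenvalues M0 x0 & forall j, x t j @[t --> U] --> x0 j.
Proof.
move=> UU MM0 Mx.
have Mb : \forall t \near U, forall i, forall k, `|M t i k| <= `|M0 i k| + 1.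
  apply: filter_forall => i; apply: filter_forall => k.
  have h : `|M t i k| @[t --> U] --> `|M0 i k| by apply: cvg_norm; exact: MM0.
  near=> t; rewrite -lerBlDl (le_trans (real_ler_norm _)) ?realB ?normr_real//.
  rewrite ltW// distrC; near: t.
  by move/cvgrPdist_lt: h; exact.
have /choice[x0 xx0] : forall j, exists l : R[i], x t j @[t --> U] --> l.
  move=> j; apply: (@ultra_bounded_cvg _ _ _ _ (\sum_i \sum_k (`|M0 i k| + 1))).
  near=> t.
  apply: le_trans (eigenvalue_bound (lists_eigenvalues_root j (Mx t))) _.
  have h : forall i k, `|M t i k| <= `|M0 i k| + 1 by near: t.
  by apply: ler_sum => i _; apply: ler_sum => k _; exact: h.
exists x0 => //; apply/lists_eigenvaluesP => z.
have h1 : \det (z%:M - M t) @[t --> U] --> \det (z%:M - M0).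
  apply: cvg_det => i k; rewrite !mxE.
  by under eq_fun do rewrite !mxE; apply: cvgB; [exact: cvg_cst|exact: MM0].
have h2 : \prod_j (z - x t j) @[t --> U] --> \prod_j (z - x0 j).
  apply: cvg_big => [y|j _].
    by apply: cvgM; [exact: cvg_fst|exact: cvg_snd].
  by apply: cvgB; [exact: cvg_cst|exact: xx0].
apply: (cvg_unique _ h1); first exact: norm_hausdorff.
apply: cvg_trans h2; apply: near_eq_cvg; near=> t.
by have /lists_eigenvaluesP -> := Mx t.
Unshelve. all: by end_near. Qed.

(** By contradiction: counterexamples at distance less than [1 / (m + 1)] have a common limit point
    [s0] along an ultrafilter, and there the two spectra coincide. *)
Lemma eigenvalues_uniform (R : realType) (n : nat) (C : R -> 'M[R[i]]_n) :
  (forall i k, continuous (fun t => C t i k)) ->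
  forall e : R[i], 0 < e -> exists2 d : R, 0 < d & forall s t,
    0 <= s <= 1 -> 0 <= t <= 1 -> `|s - t| < d ->
    forall x, lists_eigenvalues (C s) x ->
    exists2 y, lists_eigenvalues (C t) y & forall j, `|x j - y j| < e.
Proof.
move=> Ccont e e0; apply: contrapT => nd.
(* The triple [p] packs two close points and an enumeration at the first one that no enumeration at
   the second one matches within [e]. *)
pose bad (d : R) (p : R * R * ('I_n -> R[i])) :=
  [/\ 0 <= p.1.1 <= 1, 0 <= p.1.2 <= 1, `|p.1.1 - p.1.2| < d,
    lists_eigenvalues (C p.1.1) p.2 & forall y, lists_eigenvalues (C p.1.2) y ->
      exists j, ~~ (`|p.2 j - y j| < e)].
have /choice[p badp] : forall m : nat, exists p, bad m.+1%:R^-1 p.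
  move=> m; apply: contrapT => nbad; apply: nd.
  exists m.+1%:R^-1; first by rewrite invr_gt0.
  move=> s t s01 t01 st x Cx; apply: contrapT => ny.
  apply: nbad; exists (s, t, x); split=> // y Cy.
  apply: contrapT => ne; apply: ny; exists y => // j.
  by apply: contrapT => /negP nj; apply: ne; exists j.
have [U [UU oU]] := @ultraFilterLemma nat \oo _.
have [s0 ss0] : exists l : R, (p m).1.1 @[m --> U] --> l.
  apply: (@ultra_bounded_cvgR _ _ _ _ 1); apply: nearW => m.
  by have [/andP[? ?] _ _ _ _] := badp m; rewrite ger0_norm.
have ts0 : (p m).1.2 @[m --> U] --> s0.
  rewrite -[s0]subr0.
  under eq_fun => m do rewrite -[(p m).1.2](subKr (p m).1.1).
  apply: cvgB; first exact: ss0.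
  apply/cvgr0Pnorm_lt => d d0.
  have /oU := near_infty_natSinv_lt (PosNum d0).
  apply: filterS => m; apply: lt_trans.
  by have [] := badp m.
have /choice[y Cy] := fun m : nat => lists_eigenvalues_exists (C (p m).1.2).
have [x0 Cx0 xx0] : exists2 x0, lists_eigenvalues (C s0) x0 &
    forall j, (p m).2 j @[m --> U] --> x0 j.
  apply: (@ultra_eigenvalues _ _ _ _ (fun m => C (p m).1.1)).
    by move=> i k; exact: (cvg_comp _ _ ss0 (@Ccont i k s0)).
  by move=> m; have [] := badp m.
have [y0 Cy0 yy0] : exists2 y0, lists_eigenvalues (C s0) y0 &
    forall j, y m j @[m --> U] --> y0 j.
  apply: (@ultra_eigenvalues _ _ _ _ (fun m => C (p m).1.2)).
    by move=> i k; exact: (cvg_comp _ _ ts0 (@Ccont i k s0)).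
  exact: Cy.
(* Both limits list the eigenvalues of [C s0]; [q] aligns them, and reordering [y m] by [q] gives a
   matching that [bad] forbids. *)
have [q x0y0] := lists_eigenvalues_unique Cx0 Cy0.
have : \forall m \near U, forall j, `|(p m).2 j - y m (q j)| < e.
  apply: filter_forall => j.
  have : ((p m).2 j - y m (q j)) @[m --> U] --> (0 : R[i]).
    by rewrite -(subrr (x0 j)) {2}x0y0; apply: cvgB; [exact: xx0|exact: yy0].
  by move=> /cvgr0Pnorm_lt; exact.
move=> /filter_ex[m xy]; have [_ _ _ _ /(_ (y m \o q))[]] := badp m.
  exact: lists_eigenvalues_perm.
by move=> j; rewrite xy.
Qed.

(** * Chains of small steps near a finite set *)

(* The indices [i] with [r i] close to some [z k] are joined by a walk with
   steps of length at most [3 h]; a loop-free one has less than [n] steps. *)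
Lemma chain_bound (K : numFieldType) (n : nat) (r : 'I_n -> K) (z : nat -> K)
    (h : K) (a b : nat) :
  (a <= b)%N ->
  (forall k, (a <= k <= b)%N -> exists i, `|z k - r i| <= h) ->
  (forall k, (a <= k < b)%N -> `|z k - z k.+1| <= h) ->
  `|z a - z b| <= h * (3 * n)%:R.
Proof.
move=> ab zr zz; pose e i j := `|r i - r j| <= h * 3%:R.
have [i ai] : exists i, `|z a - r i| <= h by apply: zr; rewrite leqnn.
have [j bj] : exists j, `|z b - r j| <= h by apply: zr; rewrite leqnn andbT.
have h0 : 0 <= h by apply: le_trans ai.
have tri (u v w : K) (c d : K) : `|u - v| <= c -> `|v - w| <= d ->
    `|u - w| <= c + d.
  by move=> uv vw; rewrite (le_trans (ler_distD v _ _))// lerD.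
(* Consecutive [r k] and [r l] are linked through [z (a + d)] and [z (a + d.+1)], three distances of
   at most [h] each. *)
have conn d l : (a + d <= b)%N -> `|z (a + d)%N - r l| <= h -> connect e i l.
  elim: d l => [|d IHd] l adb dl.
    rewrite connect1// /e (le_trans (tri _ (z a) _ h h _ _))//.
    - by rewrite distrC.
    - by rewrite addn0 in dl.
    - by rewrite -mulr2n -[h *+ 2]mulr_natr ler_wpM2l// ler_nat.
  have adb' : (a + d < b)%N by rewrite -addnS.
  have [k dk] : exists k, `|z (a + d)%N - r k| <= h.
    by apply: zr; rewrite leq_addr ltnW.
  apply: connect_trans (IHd _ (ltnW adb') dk) _; apply: connect1.
  rewrite /e mulr_natr mulrSr mulr2n; apply: (tri _ _ _ _ _ _ dl).
  apply: (tri _ (z (a + d)%N)); rewrite 1?distrC//.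
  by rewrite addnS -distrC zz// leq_addr.
have /connectP[p ip jp] : connect e i j.
  by apply: (conn (b - a)%N); rewrite subnKC.
have [q [iq jq uq]] : exists q, [/\ path e i q, j = last i q & uniq (i :: q)].
  by move: jp; case/shortenP: ip => q iq uq _ jq; exists q.
have szq : ((size q).+1 <= n)%N.
  have /card_uniqP/= <- := uq; rewrite -[leqRHS]card_ord.
  exact: max_card.
have ij : `|r i - r j| <= h * (3 * size q)%:R.
  rewrite jq; elim: q i iq {ai conn ip jp jq uq szq} => [|k q IHq] i /=.
    by rewrite subrr normr0 muln0 mulr0.
  move=> /andP[ik kq]; rewrite mulnS natrD mulrDr.
  exact: tri ik (IHq _ kq).
(* The two ends cost one [h] each, and [3 * size q + 2 <= 3 * n] because [size q < n]. *)
apply: (@le_trans _ _ (h + h * (3 * size q)%:R + h)).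
  apply: (tri _ _ _ _ _ (tri _ _ _ _ _ ai ij)); by rewrite distrC.
rewrite addrAC -mulr2n -[h *+ 2]mulr_natr -mulrDr -natrD ler_wpM2l// ler_nat.
by rewrite (leq_trans _ (leq_mul (leqnn 3) szq))// mulnS leq_add2r.
Qed.

(** * Continuous eigenvalues along a path *)

Lemma eigenvalue_grid (R : realType) (n : nat) (C : R -> 'M[R[i]]_n)
    (x0 : 'I_n -> R[i]) :
  (forall i k, continuous (fun t => C t i k)) ->
  lists_eigenvalues (C 0) x0 ->
  forall m : nat, exists N : nat, exists x : nat -> 'I_n -> R[i],
  [/\ (m < N)%N, x 0%N = x0,
    forall k, (k <= N)%N -> lists_eigenvalues (C (k%:R / N%:R)) (x k) &
    forall k, (k < N)%N -> forall j, `|x k j - x k.+1 j| < m.+1%:R^-1].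
Proof.
move=> Ccont Cx0 m.
have [|d d0 dC] := @eigenvalues_uniform _ _ C Ccont m.+1%:R^-1.
  by rewrite invr_gt0.
(* The first bound makes the mesh [1 / N] tend to 0 as [m] grows; the second puts it below [d], so
   that neighbouring spectra can be matched. *)
pose N := maxn m.+1 (Num.truncn d^-1).+1; exists N.
have N0 : (0 < N)%N by rewrite leq_max.
have NR0 : 0 < N%:R :> R by rewrite ltr0n.
have Nd : N%:R^-1 < d.
  rewrite invf_plt ?posrE// (lt_le_trans (truncnS_gt _))// ler_nat.
  exact: leq_maxr.
(* The premises stand inside the existential so that [S] is total and can be iterated; where they
   fail, any value will do. *)
have /choice[S SP] : forall p : nat * ('I_n -> R[i]), exists y, (p.1 < N)%N ->
    lists_eigenvalues (C (p.1%:R / N%:R)) p.2 ->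
    lists_eigenvalues (C (p.1.+1%:R / N%:R)) y /\
    forall j, `|p.2 j - y j| < m.+1%:R^-1.
  move=> [k x] /=; have [kN|kN] := ltnP k N; last by exists x.
  have [Cx|nCx] := pselect (lists_eigenvalues (C (k%:R / N%:R)) x); last first.
    by exists x.
  have [|||y Cy xy] := dC (k%:R / N%:R) (k.+1%:R / N%:R) _ _ _ x Cx.
  - by rewrite divr_ge0//= ler_pdivrMr// mul1r ler_nat ltnW.
  - by rewrite divr_ge0//= ler_pdivrMr// mul1r ler_nat.
  - rewrite distrC -mulrBl -natrB// subSnn mul1r.
    by rewrite gtr0_norm ?invr_gt0.
  by exists y.
pose fix x k := if k is k'.+1 then S (k', x k') else x0.
have Cx k : (k <= N)%N -> lists_eigenvalues (C (k%:R / N%:R)) (x k).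
  elim: k => [_|k IHk kN]; first by rewrite mul0r.
  by have [] := SP (k, x k) kN (IHk (ltnW kN)).
exists x; split=> //; first exact: leq_maxl.
by move=> k kN; have [] := SP (k, x k) kN (Cx k (ltnW kN)).
Qed.

(** A single ultrafilter serves for all [t], so the limits exist simultaneously and keep the labels
    [j] of the discrete trajectories. *)
Lemma continuous_eigenpaths (R : realType) (n : nat) (C : R -> 'M[R[i]]_n)
    (x0 : 'I_n -> R[i]) :
  (forall i k, continuous (fun t => C t i k)) ->
  lists_eigenvalues (C 0) x0 ->
  exists gamma : 'I_n -> R -> R[i],
  [/\ forall j, {within `[0, 1], continuous (gamma j)},
    forall t, 0 <= t <= 1 -> lists_eigenvalues (C t) (gamma^~ t) &
    forall j, gamma j 0 = x0 j].
Proof.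
move=> Ccont Cx0.
have /choice[N /choice[x xP]] := eigenvalue_grid Ccont Cx0.
have NR0 m : 0 < (N m)%:R :> R.
  by have [mN _ _ _] := xP m; rewrite ltr0n (leq_trans _ mN).
(* [k m t] is the index of the last grid point [tau m t] not beyond [t]. *)
pose k m (t : R) := Num.truncn (t * (N m)%:R).
pose tau m (t : R) : R := (k m t)%:R / (N m)%:R.
have kN m t : 0 <= t <= 1 -> (k m t <= N m)%N.
  move=> /andP[t0 t1]; rewrite truncn_le_nat.
  by rewrite (@le_lt_trans _ _ (N m)%:R) ?ltr_nat// ler_piMl// ltW.
have tau_le m t : 0 <= t -> tau m t <= t.
  by move=> t0; rewrite ler_pdivrMr// truncn_le mulr_ge0// ltW.
have tau_gt m t : 0 <= t -> t - m.+1%:R^-1 < tau m t.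
  move=> t0; rewrite ltrBlDr; apply: (@lt_le_trans _ _ (tau m t + (N m)%:R^-1)).
    rewrite -[X in _ + X]mul1r -mulrDl ltr_pdivlMr// natr1 truncnS_gt//.
  by rewrite lerD2l lef_pV2 ?posrE// ler_nat; have [] := xP m.
have [U [UU oU]] := @ultraFilterLemma nat \oo _.
have near_inv (e : R) : 0 < e -> \forall m \near U, m.+1%:R^-1 < e.
  by move=> e0; have /oU := near_infty_natSinv_lt (PosNum e0).
have near_invC (e : R[i]) : 0 < e -> \forall m \near U, m.+1%:R^-1 < e.
  move=> e0; have eE : (complex.Re e)%:C = e by rewrite RRe_real// gtr0_real.
  have /near_inv : 0 < complex.Re e by rewrite -ltcR eE.
  apply: filterS => m; rewrite -ltcR eE.
  by rewrite fmorphV rmorph_nat.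
have tau_cvg (t : R) : 0 <= t -> tau m t @[m --> U] --> t.
  move=> t0; apply/cvgrPdist_lt => e e0; apply: filterS (near_inv _ e0) => m me.
  rewrite ger0_norm ?subr_ge0 ?tau_le//.
  by rewrite ltrBlDr -ltrBlDl (lt_trans _ (tau_gt _ _ _))// ltrD2l ltrN2.
have /choice[g gP] : forall t, exists y, 0 <= t <= 1 ->
    lists_eigenvalues (C t) y /\ forall j, x m (k m t) j @[m --> U] --> y j.
  move=> t; have [t01|nt] := boolP (0 <= t <= 1); last by exists x0.
  have [||y Cy xy] := @ultra_eigenvalues _ _ _ U (fun m => C (tau m t)) (C t)
    (fun m => x m (k m t)).
  - move=> i l; have /andP[t0 _] := t01.
    exact: (cvg_comp _ _ (tau_cvg t t0) (@Ccont i l t)).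
  - by move=> m; have [_ _ Cx _] := xP m; apply: Cx; exact: kN.
  - by exists y.
(* Equicontinuity near [s]: the grid points from [tau m u] to [tau m v] stay within [d + d] of [s],
   one [d] for [u] and [v] and one for the mesh. The trajectory thus stays within [h] of the
   spectrum of [C s], and [chain_bound] applies. *)
have equi (d : R) (h : R[i]) (s u v : R) m :
    (forall t, 0 <= t <= 1 -> `|t - s| < d + d ->
       forall y, lists_eigenvalues (C t) y ->
       exists2 r, lists_eigenvalues (C s) r & forall j, `|y j - r j| < h) ->
    0 <= u -> u <= v -> v <= 1 -> `|u - s| < d -> `|v - s| < d ->
    m.+1%:R^-1 < d -> m.+1%:R^-1 < h ->
    forall j, `|x m (k m u) j - x m (k m v) j| <= h * (3 * n)%:R.
  move=> sd u0 uv v1 us vs md mh j.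
  have v0 : 0 <= v by exact: le_trans uv.
  have [r Cr] := lists_eigenvalues_exists (C s).
  have [_ _ Cx xx] := xP m.
  apply: (@chain_bound _ _ r (fun l => x m l j)).
  - by apply: le_truncn; rewrite ler_wpM2r// ltW.
  - move=> l /andP[kl lk].
    have lN : (l <= N m)%N by rewrite (leq_trans lk)// kN// v0 v1.
    have ltau : tau m u <= l%:R / (N m)%:R <= tau m v.
      by rewrite !ler_pM2r ?invr_gt0// !ler_nat kl.
    have [||y Cy xy] := sd (l%:R / (N m)%:R) _ _ _ (Cx _ lN).
    + by rewrite divr_ge0//= ler_pdivrMr// mul1r ler_nat.
    + have /andP[lu lv] := ltau.
      have := tau_le m v v0; have := tau_gt m u u0.
      move: us vs md; rewrite !ltr_norml.
      move: (tau m u) (tau m v) (l%:R / _) (m.+1%:R^-1) lu lv => a b c e.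
      move=> ? ? /andP[? ?] /andP[? ?] ? ? ?.
      by apply/andP; split; lra.
    have [q yr] := lists_eigenvalues_unique Cy Cr.
    by exists (q j); rewrite -yr ltW.
  - move=> l /andP[_ lk]; rewrite ltW// (lt_trans _ mh)// xx//.
    by rewrite (leq_trans lk)// kN// v0 v1.
exists (fun j t => g t j); split.
- move=> j; apply/subspace_continuousP => s; rewrite /= in_itv/= => s01.
  apply/cvgrPdist_lt => e e0.
  (* The share [3 * n] is for the discrete trajectory, the other 2 for its distances to the limits
     at [s] and [t]. *)
  pose h : R[i] := e / (3 * n + 2)%:R.
  have h0 : 0 < h by rewrite divr_gt0// ltr0n addn2.
  have [d d0 dC] := eigenvalues_uniform Ccont h0.
  pose d2 := d / 2; have d20 : 0 < d2 by rewrite divr_gt0.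
  have dd : d2 + d2 = d by rewrite -splitr.
  near=> t.
  have t01 : 0 <= t <= 1.
    near: t; apply: filterS (withinT `[0, 1] (nbhs_filter s)) => t /=.
    by rewrite in_itv.
  have st : `|s - t| < d2.
    by near: t; apply: cvg_within; exact: (nbhsx_ballx s d2 d20).
  have [Cs gs] := gP s s01; have [Ct gt] := gP t t01.
  have gs_near : \forall m \near U, `|g s j - x m (k m s) j| < h.
    by move: (gs j) => /cvgrPdist_lt; exact.
  have gt_near : \forall m \near U, `|g t j - x m (k m t) j| < h.
    by move: (gt j) => /cvgrPdist_lt; exact.
  have [m [[[m1 m2] m3] m4]] := filter_ex (filterI (filterI
    (filterI (near_inv _ d20) (near_invC _ h0)) gs_near) gt_near).
  have st3 : `|x m (k m s) j - x m (k m t) j| <= h * (3 * n)%:R.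
    have sd w : 0 <= w <= 1 -> `|w - s| < d2 + d2 ->
       forall y, lists_eigenvalues (C w) y ->
       exists2 r, lists_eigenvalues (C s) r & forall j, `|y j - r j| < h.
      by rewrite dd => w01 ws y Cy; apply: dC ws y Cy.
    have [/andP[s0 s1] /andP[t0 t1]] := (s01, t01).
    have [le_st|/ltW le_ts] := leP s t.
      by apply: (equi d2 h s) => //; rewrite ?subrr ?normr0// distrC.
    rewrite distrC.
    by apply: (equi d2 h s) => //; rewrite ?subrr ?normr0// distrC.
  have -> : e = h + h * (3 * n)%:R + h.
    rewrite addrAC -mulr2n -[h *+ 2]mulr_natr -mulrDr -natrD addnC.
    by rewrite divfK// pnatr_eq0 addn2.
  rewrite (le_lt_trans (ler_distD (x m (k m t) j) _ _))//.
  apply: ler_ltD; last by rewrite distrC.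
  rewrite (le_trans (ler_distD (x m (k m s) j) _ _))//.
  by apply: lerD => //; exact: ltW.
- by move=> t t01; have [] := gP t t01.
- move=> j; have /gP[_ /(_ j) g0] : 0 <= (0 : R) <= 1 by rewrite lexx ler01.
  apply: (cvg_unique _ g0); first exact: norm_hausdorff.
  (* At time 0 the grid index is 0, where every trajectory starts at [x0]. *)
  apply: cvg_near_cst; apply: nearW => m.
  by have [_ <- _ _] := xP m; rewrite /k mul0r truncn0.
Unshelve. all: by end_near. Qed.

(** * Homogeneous extension from a segment to a quadrant *)

(** The retraction of the line onto [[0, 1]]; composing with it turns continuity within [[0, 1]]
    into continuity everywhere. *)
Definition clamp (R : realType) (t : R) : R := Num.max 0 (Num.min 1 t).

Lemma clamp_itv (R : realType) (t : R) : 0 <= clamp t <= 1.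
Proof. by rewrite /clamp le_max lexx ge_max ler01 ge_min lexx. Qed.

Lemma clamp_id (R : realType) (t : R) : 0 <= t <= 1 -> clamp t = t.
Proof.
by move=> /andP[t0 t1]; rewrite /clamp (min_idPr t1) (max_idPr t0).
Qed.

Lemma continuous_clamp (R : realType) (T : topologicalType) (f : R -> T) :
  {within `[0, 1], continuous f} -> continuous (f \o @clamp R).
Proof.
move=> /subspace_continuousP fc t.
have clamp_cont : {for t, continuous (@clamp R)}.
  apply: continuous_max; first exact: cvg_cst.
  by apply: continuous_min; first exact: cvg_cst.
apply: cvg_trans (fc (clamp t) _); last by rewrite /= in_itv/= clamp_itv.
move=> P; rewrite /within/= => /clamp_cont h.
apply: (@filterS _ (nbhs t) _ _ _ _ h) => s; apply.
by rewrite /= in_itv/= clamp_itv.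
Qed.

Lemma cvg_Re (R : realType) (T : Type) (F : set_system T) (u : T -> R[i])
    (l : R[i]) :
  Filter F -> u @ F --> l -> complex.Re (u t) @[t --> F] --> complex.Re l.
Proof.
move=> FF ul; apply/cvgrPdist_lt => e e0.
have e0' : 0 < e%:C by rewrite ltcR.
near=> t; rewrite -ltcR.
have -> : complex.Re l - complex.Re (u t) = complex.Re (l - u t).
  by case: (l) (u t) => ? ? [].
rewrite (le_lt_trans (normc_ge_Re _))//; near: t.
by move/cvgrPdist_lt: ul; exact.
Unshelve. all: by end_near. Qed.

Lemma continuous_itv_bounded (R : realType) (c : R -> R[i]) :
  {within `[0, 1], continuous c} ->
  exists b : R[i], forall t, 0 <= t <= 1 -> `|c t| <= b.
Proof.
move=> cc; have cc' : {within `[0, 1],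
      continuous ((fun t => complex.Re `|c t|) : R -> R)}.
  by move=> t; apply: cvg_Re; apply: cvg_norm; exact: cc.
have [s _ sP] := EVT_max ler01 cc'; exists `|c s| => t t01.
have /sP : t \in `[0, 1] by rewrite in_itv.
by rewrite -lecR !RRe_real.
Qed.

(* The 1-homogeneous extension of [c] from the segment [x + y = 1] to the
   closed quadrant; at the origin it vanishes since [0 / 0 = 0]. *)
Definition cone_ext (R : realType) (c : R -> R[i]) (x y : R) : R[i] :=
  (x + y)%:C * c (y / (x + y)).

(** Away from the origin this is a composition of continuous maps. At the origin the factor [u + v]
    tends to 0 while [c] stays bounded, its argument lying in [[0, 1]]. *)
Lemma cone_ext_continuous (R : realType) (c : R -> R[i]) (u v : R -> R) :
  continuous c -> (forall t, 0 <= u t) -> (forall t, 0 <= v t) ->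
  continuous u -> continuous v -> continuous (fun t => cone_ext c (u t) (v t)).
Proof.
move=> cc u0 v0 uc vc t.
have uv_cvg : (u s + v s)%:C @[s --> t] --> (u t + v t)%:C.
  have uv : u s + v s @[s --> t] --> u t + v t.
    by apply: cvgD; [exact: uc|exact: vc].
  exact: (cvg_comp _ _ uv (@continuous_real_complex R _)).
have [uv0|uv0] := eqVneq (u t + v t) 0; last first.
  rewrite /continuous_at/cone_ext; apply: cvgM; first exact: uv_cvg.
  have quot : v s / (u s + v s) @[s --> t] --> v t / (u t + v t).
    apply: cvgM; first exact: vc.
    by apply: cvgV => //; apply: cvgD; [exact: uc|exact: vc].
  exact: (cvg_comp _ _ quot (cc _)).
have [b cb] : exists b : R[i], forall s, 0 <= s <= 1 -> `|c s| <= b.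
  by apply: continuous_itv_bounded; exact: continuous_subspaceT.
have b0 : 0 <= b by rewrite (le_trans _ (cb 0 _))// lexx ler01.
rewrite /continuous_at/cone_ext uv0 mul0r; apply/cvgr0Pnorm_lt => e e0.
(* The bound [b] may be 0, hence the division by [b + 1]. *)
have eb0 : 0 < e / (b + 1) by rewrite divr_gt0// ltr_wpDl.
move: uv_cvg; rewrite uv0 => /cvgr0Pnorm_lt /(_ _ eb0).
apply: filterS => s uvs; rewrite normrM.
rewrite (@le_lt_trans _ _ (`|(u s + v s)%:C| * (b + 1)))//; last first.
  by rewrite -ltr_pdivlMr// ltr_wpDl.
rewrite ler_wpM2l// (@le_trans _ _ b) ?lerDl//; apply: cb.
rewrite divr_ge0 ?addr_ge0//=.
have [->|uvs0] := eqVneq (u s + v s) 0; first by rewrite invr0 mulr0.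
by rewrite ler_pdivrMr ?mul1r ?lerDr// lt_neqAle eq_sym uvs0 addr_ge0.
Qed.

(** [x A + y B] is [x + y] times the convex path at [y / (x + y)]; at the origin both are the zero
    matrix. *)
Lemma cone_ext_eigenvalues (R : realType) (n : nat) (A B : 'M[R[i]]_n)
    (c : 'I_n -> R -> R[i]) (x y : R) :
  (forall t, 0 <= t <= 1 -> lists_eigenvalues (convex_path A B t) (c^~ t)) ->
  0 <= x -> 0 <= y ->
  lists_eigenvalues (x%:C *: A + y%:C *: B) (fun j => cone_ext (c j) x y).
Proof.
move=> cP x0 y0.
have -> : x%:C *: A + y%:C *: B = (x + y)%:C *: convex_path A B (y / (x + y)).
  rewrite /convex_path scalerDr !scalerA -!rmorphM.
  have [xy0|xy0] := eqVneq (x + y) 0.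
    have [-> ->] : x = 0 /\ y = 0.
      by move: xy0 => /eqP; rewrite paddr_eq0// => /andP[/eqP-> /eqP->].
    by rewrite addr0 !mul0r.
  by rewrite mulrBr mulr1 mulrCA mulfV// mulr1 addrK.
apply: (lists_eigenvalues_scale (x := fun j => c j (y / (x + y)))).
apply: cP; rewrite divr_ge0 ?addr_ge0//=.
have [->|xy0] := eqVneq (x + y) 0; first by rewrite invr0 mulr0.
by rewrite ler_pdivrMr ?mul1r ?lerDr// lt_neqAle eq_sym xy0 addr_ge0.
Qed.

(** * Gluing over the three quadrants *)

Lemma cvg_mx (T : topologicalType) (m n : nat) (S : Type) (F : set_system S)
    (M : S -> 'M[T]_(m, n)) (M0 : 'M[T]_(m, n)) :
  Filter F -> (forall i k, M s i k @[s --> F] --> M0 i k) -> M @ F --> M0.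
Proof.
move=> FF MM0 V [P M0P PV]; apply: (@filterS _ F FF _ _ (fun s => PV (M s))).
by do 2![apply: filter_forall => ?]; apply: MM0; exact: M0P.
Qed.

(* On each of the three quadrants of [max x y >= 0] all the terms cancel but
   one cone extension: that of [c], of [d] or of [e], respectively. *)
Definition glue (R : realType) (c d e : R -> R[i]) (x y : R) : R[i] :=
  cone_ext c (Num.max x 0) (Num.max y 0)
  + cone_ext d (Num.max y 0) (Num.max (- x) 0)
  + cone_ext e (Num.max x 0) (Num.max (- y) 0)
  - (Num.max y 0)%:C * c 1 - (Num.max x 0)%:C * c 0.

Lemma cone_extx0 (R : realType) (c : R -> R[i]) (x : R) :
  cone_ext c x 0 = x%:C * c 0.
Proof. by rewrite /cone_ext addr0 mul0r. Qed.

Lemma cone_ext0x (R : realType) (c : R -> R[i]) (x : R) :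
  cone_ext c 0 x = x%:C * c 1.
Proof.
rewrite /cone_ext add0r.
by have [->|x0] := eqVneq x 0; rewrite ?rmorph0 ?mul0r// divff.
Qed.

(** On an axis an extension is linear, with slope the value of its path at an endpoint. The
    equations [d 0 = c 1] and [e 0 = c 0] say that the extensions agree on the common rays; they
    make the correction terms cancel in the first quadrant. *)
Lemma glueE (R : realType) (c d e : R -> R[i]) (x y : R) :
  d 0 = c 1 -> e 0 = c 0 -> 0 <= Num.max x y ->
  glue c d e x y = if x < 0 then cone_ext d y (- x)
                   else if y < 0 then cone_ext e x (- y) else cone_ext c x y.
Proof.
move=> dc ec; rewrite le_max /glue.
have [x0|x0] := ltP x 0; last have [y0|y0] := ltP y 0.
- move=> /= y0; have ny0 : - y <= 0 by rewrite oppr_le0.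
  have nx0 : 0 <= - x by rewrite oppr_ge0 ltW.
  rewrite (max_idPl y0) (max_idPl nx0) (max_idPr ny0).
  by rewrite cone_ext0x cone_extx0 rmorph0 !mul0r addr0 subr0 addrAC subrr
    add0r.
- move=> _; have ny0 : 0 <= - y by rewrite oppr_ge0 ltW.
  have nx0 : - x <= 0 by rewrite oppr_le0.
  rewrite (max_idPl ny0) (max_idPr nx0).
  rewrite !cone_extx0 rmorph0 !mul0r addr0 subr0.
  by rewrite addrAC subrr add0r.
- move=> _; have nx0 : - x <= 0 by rewrite oppr_le0.
  have ny0 : - y <= 0 by rewrite oppr_le0.
  rewrite (max_idPr nx0) (max_idPr ny0).
  by rewrite !cone_extx0 dc ec -!addrA -opprD [X in _ + X]addrA subrr addr0.
Qed.

(** Each term of the closed formula is continuous on the whole plane, so no pasting along the rays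
    is involved. *)
Lemma glue_continuous (R : realType) (c d e : R -> R[i]) (u v : R -> R) :
  continuous c -> continuous d -> continuous e ->
  continuous u -> continuous v -> continuous (fun t => glue c d e (u t) (v t)).
Proof.
move=> cc dc ec uc vc.
have pos_cont (w : R -> R) : continuous w ->
    continuous (fun t => Num.max (w t) 0).
  by move=> wc t; apply: continuous_max; [exact: wc|exact: cvg_cst].
have neg_cont (w : R -> R) : continuous w ->
    continuous (fun t => Num.max (- w t) 0).
  by move=> wc; apply: pos_cont => t; apply: cvgN; exact: wc.
have pos_ge0 (w : R -> R) t : 0 <= Num.max (w t) 0 by rewrite le_max lexx orbT.
have cone_cont (h : R -> R[i]) (p q : R -> R) : continuous h ->
    continuous (fun t => Num.max (p t) 0) ->
    continuous (fun t => Num.max (q t) 0) ->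
    continuous (fun t => cone_ext h (Num.max (p t) 0) (Num.max (q t) 0)).
  by move=> hc pc qc; apply: cone_ext_continuous.
have const_cont (w : R -> R) (z : R[i]) : continuous w ->
    continuous (fun t => (Num.max (w t) 0)%:C * z).
  move=> wc t; apply: cvgM; last exact: cvg_cst.
  exact: (cvg_comp _ _ (pos_cont w wc t) (@continuous_real_complex R _)).
move=> t; rewrite /continuous_at/glue.
apply: cvgB; last exact: const_cont.
apply: cvgB; last exact: const_cont.
apply: cvgD; first apply: cvgD.
- by apply: (cone_cont c u v) => //; exact: pos_cont.
- by apply: (cone_cont d v (fun t => - u t)) => //;
    [exact: pos_cont|exact: neg_cont].
- by apply: (cone_cont e u (fun t => - v t)) => //;
    [exact: pos_cont|exact: neg_cont].
Qed.

Lemma continuous_convex_path (R : realType) (n : nat) (A B : 'M[R[i]]_n) i k :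
  continuous (fun t : R => convex_path A B t i k).
Proof.
move=> t; rewrite /continuous_at/convex_path !mxE.
under eq_fun do rewrite !mxE.
apply: cvgD; apply: cvgM; try exact: cvg_cst; last first.
  exact: continuous_real_complex.
have sub : (1 - s : R) @[s --> t] --> 1 - t.
  by apply: cvgB; [exact: cvg_cst|exact: cvg_id].
exact: (cvg_comp _ _ sub (@continuous_real_complex R _)).
Qed.

(** * From convex eigenpaths to eigenpaths along [f A + g B] *)

Theorem theorem3 (R : realType) (n : nat) (A B : 'M[R[i]]_n) (f g : R -> R)
    (f_cont : {within `[0, 1], continuous f})
    (g_cont : {within `[0, 1], continuous g})
    (f0 : f 0 = 1) (g1 : g 1 = 1) (f1 : f 1 = 0) (g0 : g 0 = 0)
    (max_ge0 : forall a : R, 0 <= a <= 1 -> 0 <= Num.max (f a) (g a)) :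
  let C : R -> 'M[R[i]]_n := fun a => (f a)%:C *: A + (g a)%:C *: B in
  matrix_path C A B /\
  forall lam mu : n.-tuple R[i],
    seq_mset lam = spectrum A -> seq_mset mu = spectrum B ->
    forall p : 'S_n,
      convex_eigenpairing A B lam mu p -> eigenpairing C lam mu p.
Proof.
move=> C; split.
  split; rewrite /C ?f0 ?g0 ?f1 ?g1 ?scale1r ?scale0r ?addr0 ?add0r//.
  move=> t; apply: cvg_mx => i k.
  rewrite (_ : (fun s => _) = fun s => (f s)%:C * A i k + (g s)%:C * B i k);
    last by apply/funext => s; rewrite !mxE.
  rewrite !mxE.
  apply: cvgD; apply: cvgM; try exact: cvg_cst.
    exact: (cvg_comp _ _ (f_cont t) (@continuous_real_complex R _)).
  exact: (cvg_comp _ _ (g_cont t) (@continuous_real_complex R _)).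
move=> lam mu _ _ p [c [c_cont c_spec] c_ends].
have i0 : 0 <= (0 : R) <= 1 by rewrite lexx ler01.
have i1 : 0 <= (1 : R) <= 1 by rewrite lexx ler01.
have cP t : 0 <= t <= 1 -> lists_eigenvalues (convex_path A B t) (c^~ t).
  by move=> t01; apply/lists_eigenvalues_spectrum; exact: c_spec.
have path0 (M N : 'M[R[i]]_n) : convex_path M N 0 = M.
  by rewrite /convex_path subr0 scale1r scale0r addr0.
have path1 (M N : 'M[R[i]]_n) : convex_path M N 1 = N.
  by rewrite /convex_path subrr scale1r scale0r add0r.
(* The new eigenpaths start, index by index, at the end values of [c] at [B] and [A]; this makes the
   extensions agree on the common rays. *)
have dB : lists_eigenvalues (convex_path B (- A) 0) (c^~ 1).
  by rewrite path0 -(path1 A B); exact: cP.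
have eA : lists_eigenvalues (convex_path A (- B) 0) (c^~ 0).
  by rewrite path0 -(path0 A B); exact: cP.
have [d [d_cont dP d0]] :=
  continuous_eigenpaths (@continuous_convex_path _ _ B (- A)) dB.
have [e [e_cont eP e0]] :=
  continuous_eigenpaths (@continuous_convex_path _ _ A (- B)) eA.
pose K (h : R -> R[i]) := h \o @clamp R.
have KP (M N : 'M[R[i]]_n) (h : 'I_n -> R -> R[i]) :
    (forall t, 0 <= t <= 1 -> lists_eigenvalues (convex_path M N t) (h^~ t)) ->
    forall t, 0 <= t <= 1 ->
      lists_eigenvalues (convex_path M N t) ((fun j => K (h j))^~ t).
  by move=> hP t t01; rewrite /K/= clamp_id//; exact: hP.
have {}d0 j : K (d j) 0 = K (c j) 1 by rewrite /K/= !clamp_id.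
have {}e0 j : K (e j) 0 = K (c j) 0 by rewrite /K/= !clamp_id.
pose gamma j t :=
  glue (K (c j)) (K (d j)) (K (e j)) (f (clamp t)) (g (clamp t)).
have gammaE j t : 0 <= t <= 1 -> gamma j t =
    if f t < 0 then cone_ext (K (d j)) (g t) (- f t)
    else if g t < 0 then cone_ext (K (e j)) (f t) (- g t)
    else cone_ext (K (c j)) (f t) (g t).
  by move=> t01; rewrite /gamma clamp_id// glueE// max_ge0.
exists gamma; first split.
- move=> j; apply: continuous_subspaceT.
  by apply: (glue_continuous (c := K (c j)) (d := K (d j)) (e := K (e j))
    (u := f \o @clamp R) (v := g \o @clamp R));
    exact: continuous_clamp.
- move=> t t01; apply/lists_eigenvalues_spectrum.
  rewrite (_ : gamma^~ t = fun j =>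
    if f t < 0 then cone_ext (K (d j)) (g t) (- f t)
    else if g t < 0 then cone_ext (K (e j)) (f t) (- g t)
    else cone_ext (K (c j)) (f t) (g t)); last first.
    by apply/funext => j; exact: gammaE.
  have := max_ge0 t t01; rewrite le_max /C.
  have [ft0|ft0] := ltP (f t) 0; last have [gt0|gt0] := ltP (g t) 0.
  (* With [f t < 0] the point lies in the quadrant spanned by [B] and [- A], with coordinates [g t]
     and [- f t]. *)
  + move=> /= gt0; rewrite addrC.
    rewrite (_ : (f t)%:C *: A = (- f t)%:C *: - A); last first.
      by rewrite rmorphN scalerN scaleNr opprK.
    by apply: cone_ext_eigenvalues; [exact: KP|by []|rewrite oppr_ge0 ltW].
  + move=> _; rewrite (_ : (g t)%:C *: B = (- g t)%:C *: - B); last first.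
      by rewrite rmorphN scalerN scaleNr opprK.
    by apply: cone_ext_eigenvalues; [exact: KP|by []|rewrite oppr_ge0 ltW].
  + by move=> _; apply: cone_ext_eigenvalues; first exact: KP.
(* At the ends [(f, g)] is [(1, 0)] and [(0, 1)], where [gamma j] equals [c j 0] and [c j 1]; the
   pairing is unchanged. *)
- move=> j; have [<- <-] := c_ends j; rewrite !gammaE// f0 f1 g0 g1.
  rewrite ltxx ltr10 cone_extx0 cone_ext0x rmorph1 !mul1r.
  by rewrite /K/= !clamp_id.
Qed.
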